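(* Every sandwich function $\Psi$ gives a packing bound function $A$ on bounded subsets of Euclidean spaces as follows. Given a bounded Borel subset $C$ of $\mathbb{R}^n$, let $G(C)$ be the graph whose vertex set is $C$ and whose edge set consists of the pairs $x,y\in C$ such that $|x-y|\ge2$. Then $A(C)=\Psi(G(C))$ defines a packing bound function.
   Context: Graphs are loopless, undirected, and possibly infinite. Let $\mathbb{G}$ be the category whose objects are graphs with finite chromatic number and whose morphisms are graph homomorphisms. The join $G*H$ has vertex set the disjoint union of $V(G)$ and $V(H)$, and its edges are all edges of $G$ and $H$ together with all pairs $xy$ with $x\in V(G)$, $y\in V(H)$. A sandwich function is a function $\Psi$ from objects of $\mathbb{G}$ to nonnegative real numbers such that: (1) $\Psi(\emptyset)=0$ for the empty graph, and $\Psi(G)=1$ if $G$ consists of a single vertex; (2) if there is a morphism $G\to G'$ in $\mathbb{G}$, then $\Psi(G)\le\Psi(G')$; (3) $\Psi(G*G')=\Psi(G)+\Psi(G')$ for all $G,G'$. Let $\mathcal{B}_d$ be the set of all bounded Borel subsets of $\mathbb{R}^d$ and $\mathcal{B} = \bigcup_d \mathcal{B}_d$. Write $d(x,y)=|x-y|$ for the Euclidean metric, $d(C,C') = \inf\{d(x,x') : x\in C, x'\in C'\}$ (equal to $\infty$ if $C$ or $C'$ is empty), and $C(\varepsilon) = \{x \in \mathbb{R}^d : d(x,C)<\varepsilon\}$ for $C \subseteq \mathbb{R}^d$. A function $\psi\colon C \to C'$ (possibly between subsets of Euclidean spaces of different dimensions) is distance-increasing if $d(\psi(x),\psi(y)) \ge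 d(x,y)$ for all $x,y\in C$. A packing bound function is a map $A\colon \mathcal{B}\to[0,\infty)$ such that for all $C,C'\in\mathcal{B}$ and $\varepsilon>0$: (1) (Sphere bound) if $C$ is nonempty and contained in the interior of a ball of radius $1$, then $A(C)=1$; (2) (Lipschitz inequality) if there exists a distance-increasing function $\psi\colon C\to C'$, then $A(C)\le A(C')$; (3) (Union axiom) if $C$ and $C'$ are subsets of the same ambient space $\mathbb{R}^d$ and $d(C,C')\ge 2$, then $A(C\cup C')=A(C)+A(C')$; (4) (Mesh axiom) if $C \subseteq C'(\varepsilon)$ (in the same ambient space), then $A(\frac{1}{1+\varepsilon}C)\le A(C')$. *)

(* Defs.v *)
From HB Require Import structures.
From mathcomp Require Import all_boot all_order all_algebra.
From mathcomp Require Import lra.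
From mathcomp Require Import all_classical all_reals all_analysis.

Set Implicit Arguments.
Unset Strict Implicit.
Unset Printing Implicit Defensive.

Import Order.TTheory GRing.Theory Num.Theory.
Import numFieldNormedType.Exports.

Local Open Scope classical_set_scope.
Local Open Scope ring_scope.

Record sgraph := SGraph {
  vertex :> Type;
  edge : vertex -> vertex -> Prop;
  edge_sym : forall x y, edge x y -> edge y x;
  edge_irr : forall x, ~ edge x x }.

Definition colorable (G : sgraph) (k : nat) : Prop :=
  exists c : G -> 'I_k, forall x y : G, edge x y -> c x <> c y.

Definition finite_chromatic (G : sgraph) : Prop := exists k, colorable G k.

Definition graph_hom (G H : sgraph) : Type :=
  {f : G -> H | forall x y : G, edge x y -> edge (f x) (f y)}.

(* The objects of the category of graphs with finite chromatic number; its
   morphisms are the [graph_hom]s. *)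
Record fcgraph := FCGraph {
  fcgraph_graph :> sgraph;
  fcgraph_chromatic : finite_chromatic fcgraph_graph }.

Section Join.
Variables G H : sgraph.

Definition join_edge (x y : G + H) : Prop :=
  match x, y with
  | inl a, inl b => edge a b
  | inr a, inr b => edge a b
  | _, _ => True
  end.

Lemma join_edge_sym x y : join_edge x y -> join_edge y x.
Proof. by case: x y => x [] y //=; exact: edge_sym. Qed.

Lemma join_edge_irr x : ~ join_edge x x.
Proof. by case: x => x /=; exact: edge_irr. Qed.

Definition sgraph_join : sgraph := SGraph join_edge_sym join_edge_irr.

Lemma join_chromatic :
  finite_chromatic G -> finite_chromatic H -> finite_chromatic sgraph_join.
Proof.
move=> [k [c cP]] [l [d dP]]; exists (k + l)%N.
exists (fun x : sgraph_join =>
  match x with inl a => lshift l (c a) | inr b => rshift k (d b) end).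
move=> [] x [] y /=.
- by move=> /cP e /lshift_inj.
- by move=> _ /eqP; rewrite eq_lrshift.
- by move=> _ /eqP; rewrite eq_rlshift.
- by move=> /dP e /rshift_inj.
Qed.

End Join.

Definition fcgraph_join (G H : fcgraph) : fcgraph :=
  FCGraph (join_chromatic (fcgraph_chromatic G) (fcgraph_chromatic H)).

Record sandwich_function (R : realType) (Psi : fcgraph -> R) : Prop := {
  sandwich_ge0 : forall G, 0 <= Psi G;
  sandwich_empty : forall G : fcgraph, (G -> False) -> Psi G = 0;
  sandwich_vertex : forall G : fcgraph,
    (exists x : G, forall y : G, y = x) -> Psi G = 1;
  sandwich_hom : forall G H : fcgraph, graph_hom G H -> Psi G <= Psi H;
  sandwich_join : forall G H : fcgraph, Psi (fcgraph_join G H) = Psi G + Psi H }.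

(* The library's norm on ['rV[R]_d] is the sup norm, so the Euclidean metric is
   introduced here. The sup norm has the same open sets and the same bounded
   sets, so [open], [interior] and [bounded_set] are the library's. *)
Section Euclidean.
Variable R : realType.

Definition edist d (x y : 'rV[R]_d) : R :=
  Num.sqrt (\sum_(i < d) (x ord0 i - y ord0 i) ^+ 2).

Definition closed_eball d (c : 'rV[R]_d) (r : R) : set 'rV[R]_d :=
  [set x | edist c x <= r].

(* [+oo] if one of the sets is empty *)
Definition set_dist d (C D : set 'rV[R]_d) : \bar R :=
  ereal_inf [set (edist x y)%:E | x in C & y in D].

Definition thickening d (C : set 'rV[R]_d) (e : R) : set 'rV[R]_d :=
  [set x | (set_dist [set x] C < e%:E)%E].

Definition borel d : set (set 'rV[R]_d) := <<s @open 'rV[R]_d >>.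

Record bborel (d : nat) := BBorel {
  bborel_set :> set 'rV[R]_d;
  bborel_borel : borel bborel_set;
  bborel_bounded : bounded_set bborel_set }.

End Euclidean.

Section BBorelOps.
Variables (R : realType) (d : nat).
Implicit Types C D : bborel R d.

Lemma borelU (C D : set 'rV[R]_d) : borel C -> borel D -> borel (C `|` D).
Proof.
by move=> bC bD; exact: (@measurableU _ (g_sigma_algebraType (@open 'rV[R]_d))).
Qed.

Lemma bboundedU C D : bounded_set (C `|` D).
Proof.
have [M [_ hM]] := bborel_bounded C; have [N [_ hN]] := bborel_bounded D.
exists (Num.max M N); split; first exact: num_real.
by move=> t; rewrite gt_max => /andP[Mt Nt] x [Cx|Dx]; [exact: hM|exact: hN].
Qed.

Definition bborelU C D : bborel R d :=
  BBorel (borelU (bborel_borel C) (bborel_borel D)) (bboundedU C D).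

Lemma borel_preimage (f : 'rV[R]_d -> 'rV[R]_d) (C : set 'rV[R]_d) :
  continuous f -> borel C -> borel (f @^-1` C).
Proof.
move=> /continuousP cf.
apply: (@smallest_sub _ _ _ [set A | borel (f @^-1` A)]).
  have [b0 bD bU] := @smallest_sigma_algebra _ setT (@open 'rV[R]_d).
  split => /=; first by rewrite preimage_set0.
    by move=> A /bD; rewrite !setTD preimage_setC.
  by move=> F hF; rewrite preimage_bigcup; exact: bU.
by move=> A oA /=; apply: sub_sigma_algebra; exact: cf.
Qed.

Lemma borelZ (a : R) (C : set 'rV[R]_d) :
  borel C -> borel [set a *: x | x in C].
Proof.
move=> bC; have [->|a0] := eqVneq a 0.
  have [->|/set0P[c Cc]] := eqVneq C set0.
    rewrite image_set0.
    exact: (@measurable0 _ (g_sigma_algebraType (@open 'rV[R]_d))).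
  suff -> : [set 0 *: x | x in C] = ~` ~` [set (0 : 'rV[R]_d)].
    apply: (@measurableC _ (g_sigma_algebraType (@open 'rV[R]_d))).
    apply: sub_sigma_algebra; apply: closed_openC.
    exact: accessible_closed_set1 (hausdorff_accessible (@norm_hausdorff _ _)) _.
  rewrite setCK; apply/seteqP; split => [_ [x _ <-]|_ ->] /=.
    by rewrite scale0r.
  by exists c; rewrite // scale0r.
suff -> : [set a *: x | x in C] = ( *:%R a^-1) @^-1` C.
  by apply: borel_preimage => //; exact: scaler_continuous.
apply/seteqP; split => [_ [x Cx <-]|y Cy] /=.
  by rewrite scalerA mulVf// scale1r.
by exists (a^-1 *: y) => //; rewrite scalerA divff// scale1r.
Qed.

Lemma bboundedZ (a : R) C : bounded_set [set a *: x | x in C].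
Proof.
have [M [_ hM]] := bborel_bounded C.
exists (`|a| * (`|M| + 1)); split; first exact: num_real.
move=> t /ltW Mt _ [x Cx <-] /=; apply: le_trans Mt.
rewrite normrZ ler_wpM2l//; apply: hM => //.
by rewrite (le_lt_trans (ler_norm M))// ltrDl.
Qed.

Definition bborelZ (a : R) C : bborel R d :=
  BBorel (borelZ a (bborel_borel C)) (@bboundedZ a C).

End BBorelOps.

(* [A] is indexed by the ambient dimension; the empty sets of the various
   dimensions get the same value by the Lipschitz inequality. *)
Record packing_bound_function (R : realType) (A : forall d, bborel R d -> R) :
    Prop := {
  packing_ge0 : forall d (C : bborel R d), 0 <= A d C;
  packing_sphere : forall d (C : bborel R d) (c : 'rV[R]_d),
    C !=set0 -> C `<=` (closed_eball c 1)° -> A d C = 1;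
  packing_lipschitz : forall d d' (C : bborel R d) (C' : bborel R d')
      (psi : 'rV[R]_d -> 'rV[R]_d'),
    set_fun C C' psi ->
    (forall x y, bborel_set C x -> bborel_set C y ->
      edist x y <= edist (psi x) (psi y)) ->
    A d C <= A d' C';
  packing_union : forall d (C C' : bborel R d),
    (2%:E <= set_dist C C')%E -> A d (bborelU C C') = A d C + A d C';
  packing_mesh : forall d (C C' : bborel R d) (e : R),
    0 < e -> C `<=` thickening C' e -> A d (bborelZ (1 + e)^-1 C) <= A d C' }.

Section DistanceGraph.
Variables (R : realType) (d : nat) (C : bborel R d).

Definition far (x y : set_type C) : Prop := 2 <= edist (val x) (val y).

Lemma far_sym x y : far x y -> far y x.
Proof.
rewrite /far /edist; congr (_ <= Num.sqrt _).
by apply: eq_bigr => i _; rewrite -sqrrN opprB.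
Qed.

Lemma far_irr x : ~ far x x.
Proof.
rewrite /far /edist big1 ?sqrtr0 ?ler0n; first by rewrite leNgt ltr0n.
by move=> i _; rewrite subrr expr0n.
Qed.

Definition far_graph : sgraph := SGraph far_sym far_irr.

Lemma bborel_coord_le :
  exists M : R, forall x, bborel_set C x -> forall i, `|x ord0 i| <= M.
Proof.
have [M [_ hM]] := bborel_bounded C; exists (M + 1) => x Cx i.
apply: le_trans (hM (M + 1) _ x Cx); last by rewrite ltrDl.
rewrite [leRHS]/Num.norm /= mx_normrE; apply/bigmax_geP; right => /=.
by exists (ord0, i).
Qed.

(* Colour the points by the cells of a cubic grid of side [1 / (d + 1)]. *)
Lemma far_chromatic : finite_chromatic far_graph.
Proof.
have [M hM] := bborel_coord_le.
pose K : R := d.+1%:R; have K0 : 0 < K by rewrite ltr0n.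
pose g (t : R) := Num.truncn ((t + M) * K).
pose N := Num.truncn ((M + M) * K).
pose c (x : far_graph) : {ffun 'I_d -> 'I_N.+1} :=
  [ffun i => inord (g (val x ord0 i))].
exists #|{ffun 'I_d -> 'I_N.+1}|, (fun x => enum_rank (c x)) => x y fxy.
move=> /enum_rank_inj /ffunP cxy; suff : ~ far x y by apply.
have bnd (z : far_graph) i :
    0 <= (val z ord0 i + M) * K /\ (g (val z ord0 i) < N.+1)%N.
  have /hM/(_ i) : bborel_set C (val z) by apply: set_mem; exact: valP.
  rewrite ler_norml => /andP[h1 h2]; split.
    by rewrite mulr_ge0 ?(ltW K0)// -lerBlDr sub0r.
  by rewrite ltnS; apply: le_truncn; rewrite ler_pM2r// lerD2r.
have cell i : `|val x ord0 i - val y ord0 i| < K^-1.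
  have [x0 xN] := bnd x i; have [y0 yN] := bnd y i.
  have := cxy i; rewrite !ffunE => /(congr1 val); rewrite /= !inordK// => gxy.
  have /andP[x1 x2] := truncn_itv x0; have /andP[y1 y2] := truncn_itv y0.
  move: x1 x2; rewrite -/(g _) gxy => x1 x2.
  rewrite -/(g _) in y1 y2.
  rewrite -[ltRHS]mul1r ltr_pdivlMr// -[X in _ * X]gtr0_norm// -normrM ltr_norml.
  by apply/andP; move: x1 x2 y1 y2; rewrite -!natr1; split; lra.
apply/negP; rewrite -ltNge /edist.
have -> : (2 : R) = Num.sqrt (2 ^+ 2) by rewrite sqrtr_sqr ger0_norm.
rewrite ltr_sqrt ?exprn_gt0//.
apply: (@le_lt_trans _ _ (\sum_(i < d) K^-1)).
  apply: ler_sum => i _; rewrite -real_normK ?num_real// expr2.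
  have K1 : K^-1 <= 1 by rewrite invf_le1// ler1n.
  apply: le_trans (_ : 1 * K^-1 <= _); last by rewrite mul1r.
  by apply: ler_pM => //; [exact: le_trans (ltW (cell i)) K1|exact: ltW].
rewrite sumr_const card_ord -[X in X < _]mulr_natl ltr_pdivrMr//.
by rewrite /K -natr1; have := ler0n R d; lra.
Qed.

Definition distance_graph : fcgraph := FCGraph far_chromatic.

End DistanceGraph.

(* Main.v *)
(* Each axiom of a packing bound function comes from graph homomorphisms: a
   set of diameter less than 2 has an edgeless graph, distance-increasing maps
   preserve edges, and the graph of the union of two sets at distance at least
   2 is homomorphically equivalent to the join of their graphs. For the mesh
   axiom, send [x / (1 + e)] to a point of [C'] within [e] of [x]: points
   [x / (1 + e)] at mutual distance at least 2 come from points at distance at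
   least 2 + 2e, whose images are at distance more than 2. *)
From mathcomp Require Import all_boot all_order all_algebra.
From mathcomp Require Import ring lra.
From mathcomp Require Import all_classical all_reals all_analysis.
Require Import Defs.

Set Implicit Arguments.
Unset Strict Implicit.
Unset Printing Implicit Defensive.

Import Order.TTheory GRing.Theory Num.Theory.
Import numFieldNormedType.Exports.

Local Open Scope classical_set_scope.
Local Open Scope ring_scope.

(** Cauchy-Schwarz: the nonnegative sum of the squares of [B * a i - S * b i] expands to
    [B * (A * B - S ^+ 2)], and a positive [B] can be cancelled. *)
Lemma sum_mul_sqr_le (R : realFieldType) (I : finType) (a b : I -> R) :
  (\sum_i a i * b i) ^+ 2 <= (\sum_i a i ^+ 2) * (\sum_i b i ^+ 2).
Proof.
set S := \sum_i a i * b i; set A := \sum_i a i ^+ 2.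
set B := \sum_i b i ^+ 2.
have B0 : 0 <= B by apply: sumr_ge0 => i _; exact: sqr_ge0.
have : 0 <= \sum_i (B * a i - S * b i) ^+ 2.
  by apply: sumr_ge0 => i _; exact: sqr_ge0.
have -> : \sum_i (B * a i - S * b i) ^+ 2 = B * (A * B - S ^+ 2).
  transitivity (\sum_i (B ^+ 2 * a i ^+ 2 - 2 * B * S * (a i * b i) +
                        S ^+ 2 * b i ^+ 2)).
    by apply: eq_bigr => i _; ring.
  by rewrite big_split sumrB -!mulr_sumr -/A -/B -/S /=; ring.
(* If [B = 0], every [b i] vanishes, so [S = 0] as well. *)
move: B0; rewrite le_eqVlt => /predU1P[B0 _|B0].
  suff -> : S = 0 by rewrite -B0 expr0n mulr0.
  apply: big1 => i _; suff /eqP : b i ^+ 2 = 0.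
    by rewrite sqrf_eq0 => /eqP ->; rewrite mulr0.
  by apply: (psumr_eq0P _ (esym B0)) => // j _; exact: sqr_ge0.
by rewrite pmulr_rge0// subr_ge0.
Qed.

Section EuclideanDistance.
Variables (R : realType) (d : nat).
Implicit Types x y z c : 'rV[R]_d.

Lemma edistC x y : edist x y = edist y x.
Proof.
by congr Num.sqrt; apply: eq_bigr => i _; rewrite -sqrrN opprB.
Qed.

(** After squaring, only the cross term has to be compared, and Cauchy-Schwarz bounds it. *)
Lemma edist_triangle y x z : edist x z <= edist x y + edist y z.
Proof.
pose a i := x ord0 i - y ord0 i; pose b i := y ord0 i - z ord0 i.
rewrite -[leRHS]ger0_norm ?addr_ge0 ?sqrtr_ge0// -sqrtr_sqr.
rewrite ler_wsqrtr// sqrrD !sqr_sqrtr; last 2 first.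
  1,2: by apply: sumr_ge0 => i _; exact: sqr_ge0.
rewrite -/(\sum_i a i ^+ 2) -/(\sum_i b i ^+ 2).
have -> : \sum_i (x ord0 i - z ord0 i) ^+ 2 =
    \sum_i a i ^+ 2 + (\sum_i a i * b i) *+ 2 + \sum_i b i ^+ 2.
  rewrite -sumrMnl -!big_split; apply: eq_bigr => i _ /=.
  by rewrite -sqrrD; congr (_ ^+ 2); rewrite /a /b; ring.
rewrite lerD2r lerD2l lerMn2r/= /edist -sqrtrM; last first.
  by apply: sumr_ge0 => i _; exact: sqr_ge0.
by rewrite (le_trans (ler_norm _))// -sqrtr_sqr ler_wsqrtr// sum_mul_sqr_le.
Qed.

Lemma edistZ (k : R) x y : edist (k *: x) (k *: y) = `|k| * edist x y.
Proof.
rewrite -sqrtr_sqr -sqrtrM ?sqr_ge0// mulr_sumr; congr Num.sqrt.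
by apply: eq_bigr => i _; rewrite !mxE -mulrBr exprMn.
Qed.

(* An interior point at distance [r] from the centre could be pushed radially
   outwards without leaving the ball. *)
Lemma interior_eball c (r : R) x : 0 < r ->
  (closed_eball c r)° x -> edist c x < r.
Proof.
move=> r0 intx; have := interior_subset intx; rewrite /closed_eball /=.
rewrite le_eqVlt => /predU1P[cxr|//].
pose f (t : R) : 'rV[R]_d := c + t *: (x - c).
have cf : {for 1, continuous f}.
  by apply: cvgD; [exact: cvg_cst|exact: cvgZr_tmp].
have f1 : f 1 = x by rewrite /f scale1r addrC subrK.
have : \forall t \near (1 : R), closed_eball c r (f t).
  by apply: cf; rewrite f1.
case/nbhs_ballP => e /= e0 he.
have /he : ball (1 : R) e (1 + e / 2).
  by rewrite /ball /= opprD addrA subrr add0r normrN gtr0_norm; lra.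
rewrite /closed_eball /=.
suff -> : edist c (f (1 + e / 2)) = (1 + e / 2) * r by nra.
have e1 : 0 < 1 + e / 2 by lra.
rewrite -cxr -[in RHS](gtr0_norm e1) -edistZ; congr Num.sqrt.
by apply: eq_bigr => i _; rewrite !mxE; ring.
Qed.

Lemma set_dist_le (C D : set 'rV[R]_d) x y :
  C x -> D y -> (set_dist C D <= (edist x y)%:E)%E.
Proof. by move=> Cx Dy; apply: ereal_inf_lbound; exists x => //; exists y. Qed.

Lemma thickeningP (C : set 'rV[R]_d) (e : R) x :
  thickening C e x -> exists2 y, C y & edist x y < e.
Proof.
rewrite /thickening /= /set_dist => /ereal_inf_lt[_ [_ -> [y Cy <-]]].
by rewrite lte_fin; exists y.
Qed.

End EuclideanDistance.

Lemma distance_graphP (R : realType) d (C : bborel R d)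
  (x : distance_graph C) : bborel_set C (val x).
Proof. by apply: set_mem; exact: valP. Qed.

Section Sandwich.
Variables (R : realType) (Psi : fcgraph -> R).
Hypothesis PsiP : sandwich_function Psi.

(** Constant maps in both directions make such a graph homomorphically equivalent to a single
    vertex; [x] is the image of that vertex. *)
Lemma sandwich_edgeless (G : fcgraph) (x : G) :
  (forall y z : G, ~ edge y z) -> Psi G = 1.
Proof.
move=> noedge.
pose K : sgraph := @SGraph unit (fun _ _ => False)
  (fun _ _ => id) (fun _ => id).
have Kc : finite_chromatic K by exists 1%N, (fun=> ord0).
pose K1 := FCGraph Kc.
have <- : Psi K1 = 1 by apply: (sandwich_vertex PsiP); exists tt => -[].
apply/eqP; rewrite eq_le; apply/andP; split; apply: (sandwich_hom PsiP).
  by exists (fun=> tt) => y z /noedge.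
by exists (fun=> x).
Qed.

(** Serves both the Lipschitz and the mesh axiom: only the threshold 2 has to be respected, since
    the map for the mesh axiom need not be distance-increasing. *)
Lemma distance_graph_le d d' (C : bborel R d) (D : bborel R d')
    (f : 'rV[R]_d -> 'rV[R]_d') :
  set_fun C D f ->
  (forall x y, bborel_set C x -> bborel_set C y ->
     2 <= edist x y -> 2 <= edist (f x) (f y)) ->
  Psi (distance_graph C) <= Psi (distance_graph D).
Proof.
move=> CD far_f; apply: (sandwich_hom PsiP).
exists (fun x : distance_graph C =>
  SigSub (mem_set (CD _ (distance_graphP x))) : distance_graph D) => x y.
by apply: far_f; exact: distance_graphP.
Qed.

Lemma distance_graphU d (C D : bborel R d) : (2%:E <= set_dist C D)%E ->
  Psi (distance_graph (bborelU C D)) =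
  Psi (distance_graph C) + Psi (distance_graph D).
Proof.
move=> CD; rewrite -(sandwich_join PsiP).
have farCD x y : bborel_set C x -> bborel_set D y -> 2 <= edist x y.
  by move=> Cx Dy; rewrite -lee_fin (le_trans CD)// set_dist_le.
apply/eqP; rewrite eq_le; apply/andP; split; apply: (sandwich_hom PsiP).
  have memD (x : distance_graph (bborelU C D)) :
      val x \notin bborel_set C -> val x \in bborel_set D.
    by rewrite notin_setE => nCx; apply/mem_set; case: (distance_graphP x).
  pose f (x : distance_graph (bborelU C D)) :
      fcgraph_join (distance_graph C) (distance_graph D) :=
    match boolP (val x \in bborel_set C) with
    | AltTrue Cx => inl (SigSub Cx)
    | AltFalse nCx => inr (SigSub (memD x nCx))
    end.
  (* An edge inside one side stays an edge, and the join connects all pairs from different sides. *)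
  exists f => x y xy; rewrite /f.
  by case: {-}_ / boolP => Cx; case: {-}_ / boolP => Cy.
have inC (x : distance_graph C) : val x \in bborel_set (bborelU C D).
  by apply: mem_set; left; exact: distance_graphP.
have inD (x : distance_graph D) : val x \in bborel_set (bborelU C D).
  by apply: mem_set; right; exact: distance_graphP.
(* Conversely, the inclusions glue to a homomorphism: the cross edges of the join are sent to edges
   by [farCD]. *)
exists (fun x : fcgraph_join (distance_graph C) (distance_graph D) =>
  match x with
  | inl a => SigSub (inC a) : distance_graph (bborelU C D)
  | inr b => SigSub (inD b)
  end) => -[] x [] y //= _; first by apply: farCD; exact: distance_graphP.
by rewrite /far edistC; apply: farCD; exact: distance_graphP.
Qed.

End Sandwich.

Theorem theorem3p1 (R : realType) (Psi : fcgraph -> R) :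
  sandwich_function Psi ->
  packing_bound_function
    (fun (d : nat) (C : bborel R d) => Psi (distance_graph C)).
Proof.
move=> PsiP; split.
- by move=> d C; exact: (sandwich_ge0 PsiP).
- move=> d C c [x0 Cx0] Cball.
  (* Strictness is essential: antipodal points of the closed ball are at distance exactly 2 and
     would be adjacent. *)
  have close (x : distance_graph C) : edist c (val x) < 1.
    by apply: interior_eball => //; apply: Cball; exact: distance_graphP.
  apply: (sandwich_edgeless PsiP (SigSub (mem_set Cx0) : distance_graph C)).
  move=> x y; apply/negP; rewrite -ltNge.
  rewrite (le_lt_trans (edist_triangle c _ _))// edistC.
  by have := close x; have := close y; lra.
- move=> d d' C C' psi CC' incr; apply: (distance_graph_le PsiP CC').
  by move=> x y Cx Cy /le_trans; apply; exact: incr.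
- by move=> d C C'; exact: distance_graphU.
- move=> d C C' e e0 Ce.
  have e1 : 0 < 1 + e by lra.
  (* Stated for every [x], with the dummy value 0 outside [C], so that choice yields a total
     function [g]. *)
  have near_pt x : exists y, bborel_set C x ->
      bborel_set C' y /\ edist x y < e.
    have [/Ce/thickeningP[y C'y xy]|nCx] := pselect (bborel_set C x).
      by exists y.
    by exists 0.
  have [g gP] := choice near_pt.
  apply: (distance_graph_le PsiP (f := fun z => g ((1 + e) *: z))).
    move=> _ [x Cx <-] /=.
    by rewrite scalerA divff ?gt_eqF// scale1r; exact: (gP x Cx).1.
  move=> _ _ [x Cx <-] [y Cy <-].
  rewrite edistZ gtr0_norm ?invr_gt0// mulrC ler_pdivlMr//.
  rewrite !scalerA divff ?gt_eqF// !scale1r => xy.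
  have [_ xg] := gP x Cx; have [_ yg] := gP y Cy.
  (* Two triangle inequalities give [2 * (1 + e) <= edist x y < edist (g x) (g y) + 2 * e]. *)
  have := edist_triangle (g x) x y; have := edist_triangle (g y) (g x) y.
  by rewrite (edistC (g y)); lra.
Qed.
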